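(* Let $L_1=0$, $L_2=(1\ 2)$, $L_3=(1\ 3)+(2\ 3)$ be the Jucys--Murphy elements of $\mathbb{Z}S_3$, and let $M_0=\{m_\lambda(L_1,L_2,L_3)\mid \lambda \text{ a partition with } \ell(\lambda)\le 3\}$. There are exactly four $\mathbb{Z}$-bases for the centre $Z(\mathbb{Z}S_3)$ consisting solely of elements from $M_0$: $\{m_\emptyset,m_1,m_2\}$, $\{m_\emptyset,m_1,m_{1,1}\}$, $\{m_\emptyset,m_1,m_{2,2}\}$ and $\{m_1,m_2,m_{2,2}\}$.
   Context: A partition $\lambda=(\lambda_1,\dots,\lambda_r)$ is a weakly decreasing finite sequence of positive integers, with $\ell(\lambda)=r$; the empty partition $\emptyset$ is allowed. For $r\le 3$, $m_\lambda(X_1,X_2,X_3)$ is the sum of all distinct monomials of the form $X_{\sigma(1)}^{\lambda_1}\cdots X_{\sigma(r)}^{\lambda_r}$, $\sigma\in S_3$ (each with coefficient $1$), and $m_\emptyset=1$. We write $m_{\lambda_1,\dots,\lambda_r}$ for $m_\lambda(L_1,L_2,L_3)\in\mathbb{Z}S_3$. The elements $L_i$ commute, and symmetric polynomials in them lie in $Z(\mathbb{Z}S_3)$. *)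

(* Defs.v *)
From HB Require Import structures.
From mathcomp Require Import all_boot all_order all_algebra all_fingroup.
From mathcomp Require Import boolp classical_sets functions cardinality.
From mathcomp Require Import mpoly.

Set Implicit Arguments.
Unset Strict Implicit.
Unset Printing Implicit Defensive.

Import GRing.Theory.
Local Open Scope ring_scope.
Local Open Scope classical_set_scope.

(* The alias keeps the convolution product apart from the pointwise product
   that {ffun gT -> int} already carries. *)
Definition zgroup_ring (gT : finGroupType) := {ffun gT -> int}.

Section ZGroupRing.
Variable gT : finGroupType.
Local Notation ZG := (zgroup_ring gT).

HB.instance Definition _ := GRing.Zmodule.on ZG.

Definition zgr_delta (g : gT) : ZG := [ffun x => (x == g)%:R].
Definition zgr_mul (a b : ZG) : ZG :=
  [ffun x => \sum_(y : gT) a y * b (y^-1 * x)%g].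

Fact zgr_mulA : associative zgr_mul.
Proof.
move=> a b c; apply/ffunP=> x; rewrite !ffunE.
under eq_bigr => y _ do rewrite ffunE mulr_sumr.
under [RHS]eq_bigr => y _ do rewrite ffunE mulr_suml.
rewrite [RHS]exchange_big /=; apply: eq_bigr => y _.
rewrite [RHS](reindex_inj (mulgI y)) /=; apply: eq_bigr => z _.
by rewrite mulrA mulKg invMg mulgA.
Qed.

Fact zgr_mul1 : left_id (zgr_delta 1%g) zgr_mul.
Proof.
move=> a; apply/ffunP=> x; rewrite ffunE (bigD1 1%g) //= big1 => [|y y1].
  by rewrite ffunE eqxx mul1r invg1 mul1g addr0.
by rewrite ffunE (negPf y1) mul0r.
Qed.

Fact zgr_mulr1 : right_id (zgr_delta 1%g) zgr_mul.
Proof.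
move=> a; apply/ffunP=> x; rewrite ffunE (bigD1 x) //= big1 => [|y yx].
  by rewrite ffunE mulVg eqxx mulr1 addr0.
by rewrite ffunE -eq_mulVg1 (negPf yx) mulr0.
Qed.

Fact zgr_mulDl : left_distributive zgr_mul +%R.
Proof.
move=> a b c; apply/ffunP=> x; rewrite !ffunE -big_split /=.
by apply: eq_bigr => y _; rewrite ffunE mulrDl.
Qed.

Fact zgr_mulDr : right_distributive zgr_mul +%R.
Proof.
move=> a b c; apply/ffunP=> x; rewrite !ffunE -big_split /=.
by apply: eq_bigr => y _; rewrite ffunE mulrDr.
Qed.

Fact zgr_delta1_neq0 : zgr_delta 1%g != 0.
Proof. by apply/eqP=> /ffunP/(_ 1%g); rewrite !ffunE eqxx. Qed.

HB.instance Definition _ := GRing.Zmodule_isNzRing.Build ZG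
  zgr_mulA zgr_mul1 zgr_mulr1 zgr_mulDl zgr_mulDr zgr_delta1_neq0.

Lemma zgr_deltaM g h : zgr_delta (g * h)%g = zgr_delta g * zgr_delta h.
Proof.
apply/ffunP=> x; rewrite !ffunE (bigD1 g) //= big1 => [|y yg].
  by rewrite !ffunE eqxx mul1r addr0 (canF_eq (mulKVg g)).
by rewrite ffunE (negPf yg) mul0r.
Qed.

End ZGroupRing.

Definition ring_center (R : nzRingType) : set R :=
  [set z | forall x : R, z * x = x * z].
Arguments ring_center : clear implicits.

Definition Z_independent (V : zmodType) (B : set V) : Prop :=
  forall (s : seq V) (c : V -> int), uniq s -> [set` s] `<=` B ->
    \sum_(v <- s) v *~ c v = 0 -> {in s, forall v, c v = 0}.

Definition Z_span (V : zmodType) (B : set V) : set V :=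
  [set v | exists (s : seq V) (c : V -> int),
     [set` s] `<=` B /\ v = \sum_(u <- s) u *~ c u].

Definition is_Z_basis (V : zmodType) (U B : set V) : Prop :=
  Z_independent B /\ Z_span B = U.

Definition is_partition (lam : seq nat) : bool :=
  sorted geq lam && (0%N \notin lam).

(* The parts beyond the length of lam are read as 0, so that only the first
   [size lam] factors of the product matter (provided size lam <= n). *)
Definition monomial (n : nat) (lam : seq nat) (s : 'S_n) : {mpoly int[n]} :=
  \prod_(j < n) 'X_(s j) ^+ nth 0%N lam j.

Definition monomial_sym (n : nat) (lam : seq nat) : {mpoly int[n]} :=
  \sum_(p <- undup [seq monomial lam s | s : 'S_n]) p.

Local Notation ZS3 := (zgroup_ring ('S_3 : finGroupType)).

(* The letters 1, 2, 3 are the ordinals 0, 1, 2 of 'I_3. *)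
Definition transp (i j : nat) : ZS3 := zgr_delta (tperm (inord i) (inord j)).

Definition JM : 3.-tuple ZS3 :=
  [tuple 0; transp 0 1; transp 0 2 + transp 1 2].

Lemma JM_sumE (i : 'I_3) : tnth JM i = \sum_(j < 3 | (j < i)%N) transp j i.
Proof.
rewrite !big_mkcond !big_ord_recl big_ord0 /=.
by case: i => [[|[|[|//]]] ?]; rewrite (tnth_nth 0) /= ?addr0 ?add0r.
Qed.

(* mmap multiplies the values of the variables in increasing order of the
   indices; here they commute, so this is the usual evaluation. *)
Definition eval_JM (p : {mpoly int[3]}) : ZS3 := mmap intr (tnth JM) p.

Lemma JM_comm (i j : 'I_3) : tnth JM i * tnth JM j = tnth JM j * tnth JM i.
Proof.
have inordE (k l : nat) : (k < 3)%N -> (l < 3)%N ->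
    (inord k == inord l :> 'I_3) = (k == l).
  by move=> k3 l3; rewrite -val_eqE /= !inordK.
have t23 : JM`_1 * JM`_2 = JM`_2 * JM`_1.
  rewrite /= mulrDr mulrDl addrC -!zgr_deltaM.
  congr (zgr_delta _ + zgr_delta _).
    by rewrite [RHS]conjgC tpermJ tpermL tpermD ?inordE // tpermC.
  by rewrite [RHS]conjgC tpermJ tpermR tpermD ?inordE // tpermC.
case: i => [[|[|[|//]]] ?]; case: j => [[|[|[|//]]] ?];
  by rewrite !(tnth_nth 0) ?mulr0 ?mul0r // [LHS]/= ?t23.
Qed.

Definition m_JM (lam : seq nat) : ZS3 := eval_JM (monomial_sym 3 lam).

Definition M0 : set ZS3 :=
  [set m_JM lam | lam in [set lam | is_partition lam && (size lam <= 3)%N]].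

(* Main.v *)
(* Put C = L2 L3, the sum of the two 3-cycles.  As L2^2 = 1, we have L3 = L2 C and
   every monomial in L2, L3 is L2^e C^b; the relation C^2 = 2 + C gives
   C^(n+1) = 2 J_n + J_(n+1) C with J the Jacobsthal numbers
   (J_(n+2) = J_(n+1) + 2 J_n).  The centre has basis 1, T = L2 + L3, C, and each
   m_lambda is either "odd", y T with y >= 0, or "even", x + z C.  A basis taken
   from these has exactly one odd element, which must be T = m_1, and two even
   ones, with x z' - x' z = 1 or -1; the residues of J modulo 2 and 4 and its
   smallest values leave only four possibilities. *)
Require Import Defs.
From mathcomp Require Import all_boot all_order all_algebra all_fingroup.
From mathcomp Require Import boolp classical_sets functions cardinality.
From mathcomp Require Import mpoly zify ring.
Local Open Scope classical_set_scope.
Set Implicit Arguments.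
Unset Strict Implicit.
Unset Printing Implicit Defensive.

Import GRing.Theory.

Section S3.
Local Open Scope ring_scope.

Local Notation S3 := ('S_3 : finGroupType).
Local Notation ZS3 := (zgroup_ring S3).
Local Notation t01 := (tperm (inord 0) (inord 1) : S3).
Local Notation t02 := (tperm (inord 0) (inord 2) : S3).
Local Notation t12 := (tperm (inord 1) (inord 2) : S3).
Local Notation o0 := (@Ordinal 3 0 isT).
Local Notation o1 := (@Ordinal 3 1 isT).
Local Notation o2 := (@Ordinal 3 2 isT).

(** * The six elements of S_3, compared through their value lists *)

Lemma inord3E : ((inord 0 = o0) * (inord 1 = o1) * (inord 2 = o2))%type.
Proof. by do !split; apply/val_inj; rewrite /= inordK. Qed.

Definition graph3 (s : 'S_3) : seq nat := [:: val (s o0); val (s o1); val (s o2)].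

Lemma ord3_cases (P : 'I_3 -> Prop) : P o0 -> P o1 -> P o2 -> forall i, P i.
Proof.
move=> P0 P1 P2 [[|[|[|//]]] i3].
- by rewrite (_ : Ordinal i3 = o0) //; apply/val_inj.
- by rewrite (_ : Ordinal i3 = o1) //; apply/val_inj.
- by rewrite (_ : Ordinal i3 = o2) //; apply/val_inj.
Qed.

Lemma graph3_inj : injective graph3.
Proof.
move=> s t [e0 e1 e2]; apply/permP; apply: ord3_cases; exact/val_inj.
Qed.

Lemma tpermE (T : finType) (x y z : T) :
  tperm x y z = if z == x then y else if z == y then x else z.
Proof. by rewrite permE. Qed.

Definition elts3 : seq S3 := [:: 1%g; t01; t02; t12; (t01 * t02)%g; (t01 * t12)%g].

Lemma graph3_elts3 : [seq graph3 s | s <- elts3] =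
  [:: [:: 0; 1; 2]; [:: 1; 0; 2]; [:: 2; 1; 0]; [:: 0; 2; 1];
      [:: 1; 2; 0]; [:: 2; 0; 1]]%N.
Proof. by rewrite /= /graph3 !inord3E !(permM, perm1, tpermE). Qed.

(** The value lists show the six elements to be distinct, and the group has order 3!, so none is
    missing. *)
Lemma enum_S3 : perm_eq (enum S3) elts3.
Proof.
have u : uniq elts3 by rewrite -(map_inj_uniq graph3_inj) graph3_elts3.
rewrite perm_sym uniq_perm ?enum_uniq //.
have sub : {subset elts3 <= enum S3} by move=> s _; rewrite mem_enum.
have [|_ //] := uniq_min_size u sub.
by rewrite -cardE card_Sn.
Qed.

Lemma eqS3 (s t : S3) : (s == t) = (graph3 s == graph3 t).
Proof. by rewrite (inj_eq graph3_inj). Qed.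

Lemma S3_cases (P : S3 -> Prop) : P 1%g -> P t01 -> P t02 -> P t12 ->
  P (t01 * t02)%g -> P (t01 * t12)%g -> forall s, P s.
Proof.
move=> ? ? ? ? ? ? s.
have: s \in elts3 by rewrite -(perm_mem enum_S3) mem_enum.
by rewrite !inE => /orP[/eqP->|/orP[/eqP->|/orP[/eqP->|/orP[/eqP->|/orP[]/eqP->]]]].
Qed.

(** * Central elements as class functions *)

Lemma zgr_addE (gT : finGroupType) (a b : zgroup_ring gT) g : (a + b) g = a g + b g.
Proof. by rewrite ffunE. Qed.

Lemma zgr_mulrzE (gT : finGroupType) (a : zgroup_ring gT) n g : (a *~ n) g = a g * n.
Proof. by rewrite ffunMzE -mulrzr intz. Qed.

(** Commuting with [zgr_delta h], read at [g * h], is invariance under conjugation by [h].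
    Conversely the substitution y = x w^-1 turns one convolution into the other. *)
Lemma ring_centerP (gT : finGroupType) (z : zgroup_ring gT) :
  ring_center (zgroup_ring gT) z <-> forall g h, z (g ^ h)%g = z g.
Proof.
have mulE (a b : zgroup_ring gT) x : (a * b) x = \sum_y a y * b (y^-1 * x)%g.
  by rewrite ffunE.
split=> [cz g h|cz a].
  have /ffunP/(_ (g * h)%g) := cz (zgr_delta h).
  rewrite !mulE (bigD1 g) //= [in RHS](bigD1 h) //= !big1 => [|y yh|y yg].
  - by rewrite mulKg !ffunE !eqxx mulr1 mul1r !addr0.
  - by rewrite ffunE (negPf yh) mul0r.
  rewrite ffunE (_ : _ == h = false) ?mulr0 //; apply: contraNF yg.
  by move=> /eqP/(canRL (mulKVg _))/mulIg->.
apply/ffunP=> x; rewrite !mulE (reindex (fun w => x * w^-1)%g) /=; last first.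
  by exists (fun w => w^-1 * x)%g => w _; rewrite invMg ?invgK ?mulgKV ?mulKVg // mulgKV.
apply: eq_bigr => w _; rewrite mulrC invMg invgK mulgKV.
by rewrite -[z (x * _)%g](cz _ x) conjgE -mulgA mulKg.
Qed.

(** L2 + L3 and L2 L3 are the class sums of the transpositions and of the 3-cycles. *)
Definition class3 (x y z : int) : ZS3 :=
  1 *~ x + (tnth JM o1 + tnth JM o2) *~ y + (tnth JM o1 * tnth JM o2) *~ z.

Lemma JM12 : tnth JM o1 * tnth JM o2 = zgr_delta (t01 * t02)%g + zgr_delta (t01 * t12)%g.
Proof. by rewrite !(tnth_nth 0) /= mulrDr -!zgr_deltaM. Qed.

Lemma class3E x y z (s : S3) :
  class3 x y z s = if s == 1%g then x else if odd_perm s then y else z.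
Proof.
rewrite /class3 JM12 !(tnth_nth 0) /= !zgr_addE !zgr_mulrzE !zgr_addE !ffunE.
move: s; apply: S3_cases; rewrite ?odd_permM ?odd_tperm ?odd_perm1 !eqS3 /graph3
  !inord3E !(permM, perm1, tpermE) /=.
all: lia.
Qed.

(** * The elements m_lambda as sums over exponent lists *)

Definition mnm_JM (v : seq nat) : ZS3 :=
  tnth JM o0 ^+ nth 0%N v 0 * tnth JM o1 ^+ nth 0%N v 1 * tnth JM o2 ^+ nth 0%N v 2.

(** In the monomial of [s] the variable X_i carries the part of index s^-1(i). Distinct exponent
    lists give distinct monomials, so duplicates can be removed on lists of numbers, taken in the
    order of [elts3]. *)
Lemma m_JME (lam : seq nat) (a := nth 0%N lam 0) (b := nth 0%N lam 1) (c := nth 0%N lam 2) :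
  m_JM lam = \sum_(v <- undup [:: [:: a; b; c]; [:: b; a; c]; [:: c; b; a];
     [:: a; c; b]; [:: c; a; b]; [:: b; c; a]]) mnm_JM v.
Proof.
pose mon (s : 'S_3) : 'X_{1.. 3} := [multinom nth 0%N lam ((s^-1)%g i) | i < 3].
pose expo (m : 'X_{1.. 3}) := [:: m o0; m o1; m o2].
have expo_inj : injective expo.
  by move=> m m' [? ? ?]; apply/mnmP; apply: ord3_cases.
have monE s : monomial lam s = 'X_[mon s].
  by rewrite (mpolyXE _ s); apply: eq_bigr => i _; rewrite mnmE permK.
rewrite /m_JM /eval_JM /monomial_sym raddf_sum /=.
rewrite /image_mem (eq_map monE) (map_comp (fun m => 'X_[m])) undup_map_inj; last first.
  by move=> m m' /(congr1 (mcoeff m)); rewrite !mcoeffX eqxx; case: eqP.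
rewrite big_map.
transitivity (\sum_(m <- undup [seq mon s | s <- enum 'S_3]) mnm_JM (expo m)).
  apply: eq_bigr => m _; rewrite mmapX /mmap1 !big_ord_recl big_ord0 mulr1 mulrA /mnm_JM /=.
  by congr (tnth JM _ ^+ m _ * tnth JM _ ^+ m _ * tnth JM _ ^+ m _); exact/val_inj.
rewrite -(big_map expo xpredT) -undup_map_inj // -map_comp.
have /(perm_map (expo \o mon))/perm_mem/perm_undup p := enum_S3.
have e : [seq (expo \o mon) s | s <- elts3] = [:: [:: a; b; c]; [:: b; a; c]; [:: c; b; a];
     [:: a; c; b]; [:: c; a; b]; [:: b; c; a]].
  by rewrite /= /mon /expo !mnmE ?invMg ?tpermV ?invg1 !inord3E !(permM, perm1, tpermE).
by rewrite (perm_big _ p) e.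
Qed.

(** * Coordinates on the centre *)

Lemma class3_eval x y z :
  ((class3 x y z 1%g = x) * (class3 x y z t01 = y) * (class3 x y z (t01 * t02)%g = z))%type.
Proof.
by do !split; rewrite class3E !eqS3 ?odd_permM ?odd_tperm /graph3 ?inord3E
  !(permM, perm1, tpermE).
Qed.

Lemma class3D x y z x' y' z' :
  class3 x y z + class3 x' y' z' = class3 (x + x') (y + y') (z + z').
Proof. by apply/ffunP=> s; rewrite zgr_addE !class3E; case: (s == _); case: (odd_perm s). Qed.

Lemma class3Mz x y z n : class3 x y z *~ n = class3 (x * n) (y * n) (z * n).
Proof. by apply/ffunP=> s; rewrite zgr_mulrzE !class3E; case: (s == _); case: (odd_perm s). Qed.

Lemma class3_0 : class3 0 0 0 = 0.
Proof. by rewrite /class3 !mulr0z !addr0. Qed.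

Lemma class3_1 : class3 1 0 0 = 1.
Proof. by rewrite /class3 !mulr0z !addr0. Qed.

Lemma class3_inj x y z x' y' z' :
  class3 x y z = class3 x' y' z' -> [/\ x = x', y = y' & z = z'].
Proof. by move=> e; have := class3_eval x y z; rewrite e !class3_eval => -[[-> ->] ->]. Qed.

Lemma ring_center_class3 (a : ZS3) :
  ring_center ZS3 a <-> exists x y z, a = class3 x y z.
Proof.
rewrite ring_centerP; split=> [aJ|[x [y [z ->]]] g h]; last first.
  by rewrite !class3E conjg_eq1 odd_permJ.
exists (a 1%g), (a t01), (a (t01 * t02)%g); apply/ffunP; apply: S3_cases;
  rewrite class3E !eqS3 ?odd_permM ?odd_perm1 ?odd_tperm /graph3 ?inord3E !(permM, perm1, tpermE) //=.
- by rewrite -(aJ _ (tperm o1 o2)) tpermJ !tpermE.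
- by rewrite -(aJ _ (tperm o0 o2)) tpermJ !tpermE tpermC.
rewrite -(aJ _ (tperm o1 o2)) conjMg !tpermJ; congr (a _).
by apply: graph3_inj; rewrite /graph3 !(permM, perm1, tpermE).
Qed.

(** * Powers of L2 L3 and Jacobsthal numbers *)

Local Notation L2 := (tnth JM o1).
Local Notation L3 := (tnth JM o2).

Lemma JM1K : L2 * L2 = 1.
Proof. by rewrite !(tnth_nth 0) /= -zgr_deltaM tperm2. Qed.

(** Each 3-cycle squares to the other one, and the two mixed products are the identity. *)
Lemma JM12_sqr : (L2 * L3) * (L2 * L3) = 1 *~ 2 + L2 * L3.
Proof.
have c2 : (t01 * t02 * (t01 * t02) = t01 * t12)%g.
  by apply: graph3_inj; rewrite /graph3 !inord3E !(permM, perm1, tpermE).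
have d2 : (t01 * t12 * (t01 * t12) = t01 * t02)%g.
  by apply: graph3_inj; rewrite /graph3 !inord3E !(permM, perm1, tpermE).
have cd : (t01 * t02 * (t01 * t12) = 1)%g.
  by apply: graph3_inj; rewrite /graph3 !inord3E !(permM, perm1, tpermE).
have dc : (t01 * t12 * (t01 * t02) = 1)%g.
  by apply: graph3_inj; rewrite /graph3 !inord3E !(permM, perm1, tpermE).
rewrite JM12 mulrDl !mulrDr -!zgr_deltaM c2 d2 cd dc -[zgr_delta 1%g]/(1 : ZS3).
by rewrite -[_ *~ 2]/(1 + 1 : ZS3) [zgr_delta _ + 1]addrC addrACA [zgr_delta _ + _]addrC.
Qed.

Fixpoint jacobsthal (n : nat) : nat :=
  if n is (n1.+1 as n2).+1 then jacobsthal n2 + 2 * jacobsthal n1 else n.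
Local Notation J := jacobsthal.
Arguments jacobsthal : simpl never.

Lemma jacobsthalSS n : J n.+2 = (J n.+1 + 2 * J n)%N.
Proof. by []. Qed.

(** The identity J_(n+1) = 2 J_n + (-1)^n, with the sign split over both sides to stay in the
    naturals. *)
Lemma jacobsthalS n : (J n.+1 + odd n = 2 * J n + ~~ odd n)%N.
Proof. elim: n => // n; rewrite jacobsthalSS oddS; case: (odd n); lia. Qed.

Lemma jacobsthal_odd n : odd (J n.+1).
Proof. by elim: n => // n; rewrite jacobsthalSS oddD mul2n odd_double addbF. Qed.

(** Beyond J_1 = J_2 = 1 the recurrence adds J_(k+1) to 2 J_k with both odd, hence positive, so the
    value is at least 3. *)
Lemma jacobsthal_eq1 n : J n.+1 = 1%N -> (n <= 1)%N.
Proof.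
case: n => [|[|n]] //; have := jacobsthal_odd n; have := jacobsthal_odd n.+1.
by rewrite !jacobsthalSS; lia.
Qed.

Lemma JM12_exp n : (L2 * L3) ^+ n.+1 = class3 (2 * J n)%N 0 (J n.+1).
Proof.
elim: n => [|n IHn].
  by rewrite expr1 /class3 !mulr0z !add0r.
rewrite exprSr IHn jacobsthalSS /class3 !mulr0z !addr0 mulrDl.
rewrite !mulrzAl mul1r JM12_sqr mulrzDl.
rewrite -mulrzA addrCA -mulrzDr.
congr (_ *~ _ + _ *~ _); lia.
Qed.

Lemma JM1_exp n : L2 ^+ n = L2 ^+ odd n.
Proof. by rewrite -modn2 expr_mod // expr2 JM1K. Qed.

(** L2 (L2 L3) = L3, so equal coefficients at 1 and C become a multiple of T. *)
Lemma JM1_class3 x : L2 * class3 x 0 x = class3 0 x 0.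
Proof.
rewrite /class3 !mulr0z addr0 add0r addr0 mulrDr !mulrzAr mulr1 mulrA JM1K mul1r.
exact/esym/mulrzDl.
Qed.

(* Since L2^2 = 1, L3 = L2 (L2 L3). *)
Lemma mnm_JME a b : mnm_JM [:: 0; a; b]%N = L2 ^+ odd (a + b) * (L2 * L3) ^+ b.
Proof.
rewrite /mnm_JM /= expr0 mul1r -JM1_exp exprD -mulrA; congr (_ * _).
rewrite exprMn_comm ?mulrA -?exprD; last exact: JM_comm.
by rewrite [L2 ^+ (b + b)]JM1_exp addnn odd_double mul1r.
Qed.

Lemma mnm_JM0 a b c : mnm_JM [:: a.+1; b; c] = 0.
Proof. by rewrite /mnm_JM /= (tnth_nth 0) /= expr0n !mul0r. Qed.

(** * Closed forms of m_lambda by the number of parts *)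

Lemma m_JM_nil : m_JM [::] = class3 1 0 0.
Proof.
by rewrite m_JME /= big_seq1 mnm_JME !expr0 mulr1 class3_1.
Qed.

Lemma m_JM1 n : m_JM [:: n.+1] = L2 ^+ odd n.+1 * class3 (2 * J n + 1)%N 0 (J n.+1).
Proof.
rewrite m_JME /= !inE !eqseq_cons !eqxx /= !big_cons big_nil.
rewrite mnm_JM0 add0r addr0 !mnm_JME addn0 add0n -mulrDr expr0 JM12_exp.
have -> : 1 = class3 1 0 0 by rewrite class3_1.
by rewrite class3D addr0 add0r PoszD addrC.
Qed.

(** As L1 = 0, only the two monomials in L2 and L3 survive. For equal parts they would coincide and
    count once. *)
Lemma m_JM2 m n : m != n ->
  m_JM [:: m.+1; n.+1] = L2 ^+ odd (m + n) * class3 (2 * (J m + J n))%N 0 (J m.+1 + J n.+1)%N.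
Proof.
move=> mn; have nm := mn; rewrite eq_sym in nm.
rewrite m_JME /= !inE !eqseq_cons !eqxx !eqSS (negPf mn) (negPf nm) /= !big_cons big_nil.
rewrite !mnm_JM0 !add0r !addr0 !mnm_JME !addSn !addnS /= !negbK [(n + m)%N]addnC -mulrDr.
by rewrite !JM12_exp class3D addr0 -!PoszD -mulnDr.
Qed.

Lemma m_JM2d n : m_JM [:: n.+1; n.+1] = class3 (2 * J n)%N 0 (J n.+1).
Proof.
rewrite m_JME /= !inE !eqseq_cons !eqxx /= !big_cons big_nil.
rewrite !mnm_JM0 mnm_JME JM12_exp addnn odd_double mul1r.
by rewrite ?add0r ?addr0.
Qed.

Lemma m_JM3 a b c : m_JM [:: a.+1; b.+1; c.+1] = 0.
Proof.
rewrite m_JME big_seq big1 // => v; rewrite mem_undup !inE.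
by do ![case/predU1P=> [->|]]; rewrite ?mnm_JM0 // => /eqP->; rewrite mnm_JM0.
Qed.

(* The four cases are the pairs (x, z) with m_lambda = x + z C for lambda equal to
   (), to (n+1), to (n+1, n+1), and to (a, b) with a != b of the same parity. *)
Definition even_shape (x z : int) : Prop :=
  [\/ x = 1 /\ z = 0, exists n, [/\ odd n, z = J n.+1 & x = z + 2],
      exists n, x = (2 * J n)%N /\ z = J n.+1 | exists p q, x = 2 * p /\ z = 2 * q].

Lemma M0_shape (u : ZS3) : M0 u ->
  (exists y : nat, u = class3 0 y 0) \/ exists x z, u = class3 x 0 z /\ even_shape x z.
Proof.
case=> lam /andP[/andP[_ pos] size_lam] <-.
case: lam pos size_lam => [|[|a] [|[|b] [|[|c] []]]] // _ _.
- by right; exists 1, 0; rewrite m_JM_nil; split=> //; constructor 1.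
- have Ja := jacobsthalS a; rewrite m_JM1; have [ao|ae] := boolP (odd a).
    right; exists (J a.+1 + 2), (J a.+1); rewrite oddS ao mul1r.
    split; last by constructor 2; exists a.
    by congr class3; move: Ja; rewrite ao; lia.
  left; exists (J a.+1); rewrite oddS (negPf ae) (_ : (2 * J a + 1)%N = J a.+1) ?JM1_class3 //.
  by move: Ja; rewrite (negPf ae); lia.
- have [->|ab] := eqVneq a b.
    by right; exists (2 * J b)%N, (J b.+1); rewrite m_JM2d; split=> //; constructor 3; exists b.
  have Ja := jacobsthalS a; have Jb := jacobsthalS b.
  have Joa := jacobsthal_odd a; have Job := jacobsthal_odd b.
  rewrite m_JM2 //; have [e|e] := boolP (odd (a + b)).
    (* For opposite parities the signs in [jacobsthalS] cancel, so the two coefficients agree. *)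
    left; exists (J a.+1 + J b.+1)%N.
    rewrite (_ : (2 * (J a + J b))%N = (J a.+1 + J b.+1)%N) ?JM1_class3 //.
    by move: e Ja Jb; rewrite oddD; case: odd; case: odd => //; lia.
  right; eexists _, _; split; first by rewrite mul1r.
  (* A sum of two odd Jacobsthal numbers is even. *)
  constructor 4; exists (Posz (J a + J b)), (Posz ((J a.+1 + J b.+1) %/ 2)); split; lia.
(* Zero counts as an odd element with y = 0, whatever the degree. *)
- by left; exists 0%N; rewrite m_JM3 class3_0.
Qed.

(** * Pairs of even elements with determinant 1 or -1 *)

(** The coordinates of m_() paired with m_2, m_(1,1) or m_(2,2), and of m_2 paired with m_(2,2). *)
Definition det1_pair (x z x' z' : int) : Prop :=
  x = 1 /\ z = 0 /\ z' = 1 /\ (x' = 3 \/ x' = 0 \/ x' = 2)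
  \/ x = 3 /\ z = 1 /\ x' = 2 /\ z' = 1.

Lemma jacobsthal_odd_idx n : odd n -> J n.+1 = (4 * J n.-1 + 1)%N.
Proof.
case: n => //= n /negbTE no; have := jacobsthalS n; rewrite jacobsthalSS no; lia.
Qed.

Lemma jacobsthal_odd_pos n : n != 0%N -> odd (J n).
Proof. by case: n => // n _; exact: jacobsthal_odd. Qed.

(** With J_(m+1) = 4p + 1 and J_(n+1) = 4q + 1, the second equation fails modulo 4 and the first
    gives q = 2p. As q = J_(n-1) is odd unless n = 1, it follows that q = 0, hence p = J_(m-1) = 0
    and m = 1. *)
Lemma jacobsthal_odd_double m n : odd m -> odd n ->
  (2 * J m.+1 = J n.+1 + 1)%N \/ (2 * J m.+1 + 1 = J n.+1)%N -> m = 1%N /\ n = 1%N.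
Proof.
move=> mo no; rewrite !jacobsthal_odd_idx // => e.
have n1 : n.-1 = 0%N.
  by apply/eqP/negP => /negP/jacobsthal_odd_pos; lia.
have m1 : m.-1 = 0%N.
  by apply/eqP/negP => /negP/jacobsthal_odd_pos; rewrite n1 -[J 0]/0%N in e; lia.
by split; lia.
Qed.

Lemma even_shape_det x z x' z' (d := x * z' - x' * z) :
  even_shape x z -> even_shape x' z' -> d = 1 \/ d = -1 ->
  det1_pair x z x' z' \/ det1_pair x' z' x z.
Proof.
have unitP n : J n.+1 = 1%N -> J n = 0%N \/ J n = 1%N.
  by move/jacobsthal_eq1; case: n => [|[]] //; [left|right].
(* The determinant of (n+1) against (m+1, m+1). For odd m it is 2 J_(m+1) - J_(n+1); for even m it
   is J_(n+1) + 4 J_m + 2, which is too large. *)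
have mixed m n : odd n -> forall e : int,
    e = ((J n.+1)%:Z + 2) * (J m.+1)%:Z - 2 * (J m)%:Z * (J n.+1)%:Z -> e = 1 \/ e = -1 -> m = 1%N /\ n = 1%N.
  move=> no _ -> e; have := jacobsthalS m; have [mo|_] := boolP (odd m) => Jm.
    have Jm1 : 2 * (J m)%:Z = (J m.+1)%:Z + 1 by lia.
    by apply: jacobsthal_odd_double => //; move: e; rewrite Jm1; lia.
  have Jm1 : (J m.+1)%:Z = 2 * (J m)%:Z + 1 by lia.
  by have := jacobsthal_odd n; move: e; rewrite Jm1; lia.
rewrite /d => {d}.
case=> [[-> ->]|[n [no -> ->]]|[n [-> ->]]|[p [q [-> ->]]]];
  case=> [[-> ->]|[m [mo -> ->]]|[m [-> ->]]|[r [s [-> ->]]]]; rewrite /det1_pair.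
(* This settles equal shapes and pairs with a member divisible by 2, where the determinant is even,
   and the unit against (n+1), where z' = 1 forces x' = 3. *)
all: try by lia.
- by move=> d1; have /unitP : J m.+1 = 1%N; lia.
- move=> d1; have [] := mixed m n no _ erefl; first lia.
  by move=> -> ->; left; right.
- by move=> d1; have /unitP : J n.+1 = 1%N; lia.
- move=> d1; have [] := mixed n m mo _ erefl; first lia.
  by move=> -> ->; right; right.
Qed.

(** * Spans and independence of small sets *)

Lemma Z_span_ind (V : zmodType) (B : set V) (P : V -> Prop) :
    P 0 -> (forall u v, P u -> P v -> P (u + v)) ->
    (forall u n, B u -> P (u *~ n)) ->
  forall v, Z_span B v -> P v.
Proof.
move=> P0 PD PM v [s [c [sB ->]]]; rewrite big_seq.
by apply: (big_ind P) => // u us; exact/PM/sB.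
Qed.

Lemma Z_span3 (V : zmodType) (a b c v : V) : uniq [:: a; b; c] ->
  Z_span [set a; b; c] v <-> exists i j k, v = a *~ i + b *~ j + c *~ k.
Proof.
rewrite /= !inE => /and3P[/norP[ab ac] bc _]; split=> [|[i [j [k ->]]]].
  move: v; apply: Z_span_ind => [|u w [i [j [k ->]]] [i' [j' [k' ->]]]|u n [[]|] ->].
  - by exists 0, 0, 0; rewrite !mulr0z !addr0.
  - exists (i + i'), (j + j'), (k + k'); rewrite !mulrzDr addrACA.
    by congr (_ + _); rewrite addrACA.
  - by exists n, 0, 0; rewrite !mulr0z !addr0.
  - by exists 0, n, 0; rewrite !mulr0z add0r !addr0.
  - by exists 0, 0, n; rewrite !mulr0z !add0r.
exists [:: a; b; c], (fun u => if u == a then i else if u == b then j else k); split.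
  by move=> u /=; rewrite !inE => /or3P[] /eqP->; [left; left|left; right|right].
rewrite !big_cons big_nil addr0 !eqxx addrA.
by rewrite (eq_sym b) (negPf ab) (eq_sym c a) (negPf ac) (eq_sym c) (negPf bc).
Qed.

Lemma Z_independent3 (V : zmodType) (a b c : V) : uniq [:: a; b; c] ->
  (forall i j k, a *~ i + b *~ j + c *~ k = 0 -> [/\ i = 0, j = 0 & k = 0]) ->
  Z_independent [set a; b; c].
Proof.
(* Extending the coefficients by 0 outside [s] turns a relation on [s] into one on the whole
   triple. *)
move=> uniq_abc indep s f uniq_s sB; pose g u := if u \in s then f u else 0.
have sub : {subset s <= [:: a; b; c]}.
  by move=> u /sB; rewrite !inE => -[[]|] ->; rewrite eqxx ?orbT.
have p : perm_eq s [seq u <- [:: a; b; c] | u \in s].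
  apply: uniq_perm => //; first exact: filter_uniq.
  by move=> u; rewrite mem_filter; case us: (u \in s) => //=; rewrite sub.
rewrite (perm_big _ p) big_filter big_mkcond /= => sum0.
have [] := indep (g a) (g b) (g c).
  rewrite -[RHS]sum0 !big_cons big_nil addr0 addrA /g.
  by congr (_ + _ + _); case: ifP; rewrite ?mulr0z.
rewrite /g => ga gb gc u us; move: (sub u us) ga gb gc; rewrite !inE.
by case/or3P=> /eqP <-; rewrite us.
Qed.

Lemma det_basis x z x' z' (d := x * z' - x' * z) : d = 1 \/ d = -1 ->
  is_Z_basis (ring_center ZS3) [set class3 0 1 0; class3 x 0 z; class3 x' 0 z'].
Proof.
move=> d1.
have comb i j k : class3 0 1 0 *~ i + class3 x 0 z *~ j + class3 x' 0 z' *~ k =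
    class3 (x * j + x' * k) i (z * j + z' * k).
  by rewrite !class3Mz !class3D; congr class3; lia.
have uniq3 : uniq [:: class3 0 1 0; class3 x 0 z; class3 x' 0 z'].
  rewrite /= !inE; apply/and3P; split=> //; first apply/norP; first split; apply/eqP=> /class3_inj[].
  - by [].
  - by [].
  by move=> ex _ ez; move: d1; rewrite /d ex ez; lia.
split.
  apply: Z_independent3 => // i j k; rewrite comb -class3_0 => /class3_inj[e1 -> e2].
  (* Cramer's rule: eliminating one unknown leaves the other times [d], a unit. *)
  have ej : j * d = 0.
    transitivity (z' * (x * j + x' * k) - x' * (z * j + z' * k)); first by rewrite /d; ring.
    by rewrite e1 e2 !mulr0.
  have ek : k * d = 0.
    transitivity (x * (z * j + z' * k) - z * (x * j + x' * k)); first by rewrite /d; ring.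
    by rewrite e1 e2 !mulr0.
  by split=> //; case: d1 ej ek => ->; lia.
apply/seteqP; split=> v.
  rewrite Z_span3 // => -[i [j [k ->]]]; rewrite comb; apply/ring_center_class3.
  by eexists _, _, _.
move=> /ring_center_class3[X [Y [Z ->]]]; apply/Z_span3 => //.
(* Cramer's rule again; division by [d] is multiplication by [d], since d^2 = 1. *)
exists Y, (d * (X * z' - Z * x')), (d * (x * Z - z * X)).
rewrite comb.
have dd : d * d = 1 by case: d1 => ->.
congr class3.
  by rewrite -[LHS]mulr1 -dd /d; ring.
by rewrite -[LHS]mulr1 -dd /d; ring.
Qed.

Lemma Z_independent2P (V : zmodType) (B : set V) (a b : V) i j : Z_independent B ->
  B a -> B b -> a != b -> a *~ i + b *~ j = 0 -> i = 0 /\ j = 0.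
Proof.
move=> indep Ba Bb ab e; pose c u := if u == a then i else j.
have ba : (b == a) = false by rewrite eq_sym (negPf ab).
have c0 : {in [:: a; b], forall u, c u = 0}.
  apply: indep; first by rewrite /= inE ab.
    by move=> u /=; rewrite !inE => /orP[] /eqP->.
  by rewrite !big_cons big_nil addr0 /c eqxx ba.
by have := c0 a; have := c0 b; rewrite /c !inE !eqxx ba orbT => -> // ->.
Qed.

Lemma Z_independent3P (V : zmodType) (B : set V) (a b c : V) i j k : Z_independent B ->
  B a -> B b -> B c -> uniq [:: a; b; c] -> a *~ i + b *~ j + c *~ k = 0 ->
  [/\ i = 0, j = 0 & k = 0].
Proof.
move=> indep Ba Bb Bc u3 e; pose f u := if u == a then i else if u == b then j else k.
have := u3; rewrite /= !inE => /and3P[/norP[ab ac] bc _].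
have ba : (b == a) = false by rewrite eq_sym (negPf ab).
have ca : (c == a) = false by rewrite eq_sym (negPf ac).
have cb : (c == b) = false by rewrite eq_sym (negPf bc).
have c0 : {in [:: a; b; c], forall u, f u = 0}.
  apply: indep => //; first by move=> u /=; rewrite !inE => /or3P[] /eqP->.
  by rewrite !big_cons big_nil addr0 /f !eqxx ba ca cb addrA.
have := c0 a; have := c0 b; have := c0 c; rewrite /f !inE !eqxx ba ca cb !orbT.
by move=> -> // -> // ->.
Qed.

(** * The form of a basis contained in M0 *)

Lemma basis_shape (B : set ZS3) : B `<=` M0 -> is_Z_basis (ring_center ZS3) B ->
  exists x z x' z', [/\ even_shape x z, even_shape x' z',
    x * z' - x' * z = 1 \/ x * z' - x' * z = -1 &
    B = [set class3 0 1 0; class3 x 0 z; class3 x' 0 z']].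
Proof.
move=> BM0 [indep spanB].
have span x y z : Z_span B (class3 x y z).
  by rewrite spanB; apply/ring_center_class3; eexists _, _, _.
have shape u : B u -> (exists y : nat, u = class3 0 y 0) \/
    exists x z, u = class3 x 0 z /\ even_shape x z.
  by move/BM0/M0_shape.
(* An additive functional that is nonzero somewhere on the centre cannot vanish on all of the
   spanning set [B]. *)
have linP (f : ZS3 -> int) x y z :
    f 0 = 0 -> (forall u v, f (u + v) = f u + f v) ->
    (forall u n, f (u *~ n) = f u * n) -> f (class3 x y z) != 0 ->
    exists2 u, B u & f u != 0.
  move=> f0 fD fM fn0; apply: contrapT => none.
  move/eqP: fn0; apply; move: (span x y z); move: (class3 x y z).
  apply: Z_span_ind => // [u v fu fv|u n Bu]; first by rewrite fD fu fv.
  rewrite fM (_ : f u = 0) ?mul0r //; apply/eqP/negPn/negP => fu.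
  by apply: none; exists u.
have [] := linP (fun u => u t01) 0 1 0.
- by rewrite ffunE.
- by move=> u v; rewrite zgr_addE.
- by move=> u n; rewrite zgr_mulrzE.
- by rewrite class3_eval.
move=> t Bt; case: (shape t Bt) => [[y et]|[x [z [-> _]]]]; last by rewrite class3_eval.
rewrite et class3_eval => y0.
have [] := linP (fun u => u 1%g) 1 0 0.
- by rewrite ffunE.
- by move=> u v; rewrite zgr_addE.
- by move=> u n; rewrite zgr_mulrzE.
- by rewrite class3_eval.
move=> u Bu; case: (shape u Bu) => [[? ->]|[x [z [eu sx]]]]; first by rewrite class3_eval.
rewrite eu class3_eval => x0.
(* This functional kills [u] and all odd elements, so it detects an even element independent of [u].
   On the test element it equals x^2 + z^2, which is nonzero. *)
have [] := linP (fun u => x * u (t01 * t02)%g - u 1%g * z) (- z) 0 x.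
- by rewrite !ffunE; lia.
- by move=> v w; rewrite !zgr_addE; lia.
- by move=> v n; rewrite !zgr_mulrzE; ring.
- by rewrite !class3_eval; nia.
move=> v Bv; case: (shape v Bv) => [[? ->]|[x' [z' [ev sx']]]]; first by rewrite !class3_eval; lia.
rewrite ev !class3_eval => d0.
have uv : u != v.
  by apply/eqP; rewrite eu ev => /class3_inj[ex _ ez]; move: d0; rewrite ex ez; lia.
(* A further element would satisfy a nontrivial linear relation: two odd elements
   are proportional, and three even ones are related by their 2 x 2 minors. *)
have eB : B = [set t; u; v].
  apply/seteqP; split=> w; last by case=> [[]|] ->.
  move=> Bw; apply: contrapT => /not_orP[/not_orP[wt wu] wv].
  case: (shape w Bw) => [[y' ew]|[x'' [z'' [ew _]]]].
    have [] := Z_independent2P indep Bt Bw _ (_ : t *~ y' + w *~ (- y%:Z) = 0).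
    - by rewrite eq_sym; apply/eqP.
    - by rewrite et ew !class3Mz class3D -class3_0; congr class3; lia.
    by move=> _; lia.
  have [] := @Z_independent3P _ B u v w (x' * z'' - x'' * z') (x'' * z - x * z'')
    (x * z' - x' * z) indep Bu Bv Bw.
  - rewrite /= !inE negb_or uv /= andbT; apply/andP.
    by split; rewrite eq_sym; apply/eqP.
  - by rewrite eu ev ew !class3Mz !class3D -class3_0; congr class3; ring.
  by move=> _ _; lia.
have tu : t != u by apply/eqP; rewrite et eu => /class3_inj[]; lia.
have tv : t != v by apply/eqP; rewrite et ev => /class3_inj[]; lia.
have comb (X Y Z : int) : exists i j k : int,
    [/\ X = x * j + x' * k, Y = y%:Z * i & Z = z * j + z' * k].
  have := span X Y Z; rewrite eB Z_span3; last by rewrite /= !inE negb_or tu tv uv.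
  move=> [i [j [k]]]; rewrite et eu ev !class3Mz !class3D => /class3_inj[eX eY eZ].
  by exists i, j, k; split; lia.
(* All coefficients at transpositions are multiples of [y], so [y] divides 1. *)
have y1 : y = 1%N.
  have [i [j [k [_ /(congr1 absz)/esym/eqP e _]]]] := comb 0 1 0.
  by move: e; rewrite abszM muln_eq1 => /andP[/eqP].
exists x, z, x', z'; split=> //; last by rewrite eB et eu ev y1.
(* Writing 1 and C in terms of [B] inverts the 2 x 2 coordinate matrix over the integers, so its
   determinant is a unit. *)
have [i [j [k [e1 _ e2]]]] := comb 1 0 0.
have [i' [j' [k' [e3 _ e4]]]] := comb 0 0 1.
have: (x * z' - x' * z) * (j * k' - j' * k) = 1.
  transitivity ((x * j + x' * k) * (z * j' + z' * k') - (x * j' + x' * k') * (z * j + z' * k)).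
    by ring.
  by rewrite -e1 -e2 -e3 -e4.
by move=> /(congr1 absz)/eqP; rewrite abszM muln_eq1 => /andP[/eqP ? _]; lia.
Qed.

(** * The list of bases and their number *)

Lemma m_JM_values : (m_JM [::] = class3 1 0 0) * (m_JM [:: 1] = class3 0 1 0) *
  (m_JM [:: 2] = class3 3 0 1) * (m_JM [:: 1; 1] = class3 0 0 1) *
  (m_JM [:: 2; 2] = class3 2 0 1).
Proof.
do !split; rewrite ?m_JM_nil ?m_JM1 ?m_JM2d //=.
  exact: JM1_class3.
by rewrite expr0 mul1r.
Qed.

End S3.

Theorem theorem6p10 :
  let bases := [set B : set (zgroup_ring 'S_3) |
    B `<=` M0 /\ is_Z_basis (ring_center (zgroup_ring 'S_3)) B] in
  bases = [set [set m_JM [::]; m_JM [:: 1]; m_JM [:: 2]];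
               [set m_JM [::]; m_JM [:: 1]; m_JM [:: 1; 1]];
               [set m_JM [::]; m_JM [:: 1]; m_JM [:: 2; 2]];
               [set m_JM [:: 1]; m_JM [:: 2]; m_JM [:: 2; 2]]]
  /\ (bases #= `I_4)%card.
Proof.
move=> bases.
have swap12 (a b c : zgroup_ring 'S_3) : [set a; b; c] = [set b; a; c].
  by rewrite [[set a] `|` _]setUC.
have swap23 (a b c : zgroup_ring 'S_3) : [set a; b; c] = [set a; c; b].
  by rewrite setUAC.
set S1 := [set m_JM [::]; m_JM [:: 1]; m_JM [:: 2]].
set S2 := [set m_JM [::]; m_JM [:: 1]; m_JM [:: 1; 1]].
set S3 := [set m_JM [::]; m_JM [:: 1]; m_JM [:: 2; 2]].
set S4 := [set m_JM [:: 1]; m_JM [:: 2]; m_JM [:: 2; 2]].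
have M0m lam : is_partition lam && (size lam <= 3)%N -> M0 (m_JM lam) by exists lam.
have basesE : bases = [set S1; S2; S3; S4].
  apply/seteqP; split=> B.
    move=> [BM0 /(basis_shape BM0) [x [z [x' [z' [sx sx' d1 ->]]]]]].
    have := even_shape_det sx sx' d1.
    (* Exchanging the two even elements leaves the set unchanged, so one order suffices. *)
    wlog: x z x' z' {sx sx' d1} / det1_pair x z x' z'.
      by move=> wl [d|d]; [|rewrite swap23]; apply: wl; rewrite //; left.
    move=> [[-> [-> [-> [|[]] ->]]]|[-> [-> [-> ->]]]] _.
    - by left; left; left; rewrite /S1 !m_JM_values swap12.
    - by left; left; right; rewrite /S2 !m_JM_values swap12.
    - by left; right; rewrite /S3 !m_JM_values swap12.
    - by right; rewrite /S4 !m_JM_values.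
  move=> BS; split.
    by move: BS => [[[]|]|] -> u [[]|] ->; exact: M0m.
  move: BS => [[[]|]|] ->; rewrite /S1 /S2 /S3 /S4 !m_JM_values;
    [rewrite swap12 | rewrite swap12 | rewrite swap12 | ]; by apply: det_basis; lia.
split=> //; rewrite basesE.
(* Indexing the four sets by 0 to 3 reduces the count to their being pairwise distinct. *)
pose S := nth set0 [:: S1; S2; S3; S4].
have -> : [set S1; S2; S3; S4] = [set S i | i in `I_4].
  apply/seteqP; split=> B.
    by case=> [[[]|]|] ->; [exists 0%N|exists 1%N|exists 2%N|exists 3%N].
  case=> -[|[|[|[|//]]]] _ <-; rewrite /S /=; first by left; left; left.
  - by left; left; right.
  - by left; right.
  - by right.
have neq (A B : set (zgroup_ring 'S_3)) u : A u -> ~ B u -> (A == B) = false.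
  by move=> Au nBu; apply/eqP => e; apply: nBu; rewrite -e.
have S_uniq : uniq [:: S1; S2; S3; S4].
  (* Each pair is separated by an element of the first set whose coordinates differ from those of
     all members of the second. *)
  rewrite /= !inE (neq S1 S2 (m_JM [:: 2])) ?(neq S1 S3 (m_JM [:: 2]))
    ?(neq S1 S4 (m_JM [::])) ?(neq S2 S3 (m_JM [:: 1; 1]))
    ?(neq S2 S4 (m_JM [::])) ?(neq S3 S4 (m_JM [::])) //;
    first [by left; left | by right
      | by rewrite /S2 /S3 /S4 !m_JM_values => -[[]|] /class3_inj[]].
apply: inj_card_eq => i j; rewrite !inE /= => i4 j4 /eqP.
by rewrite nth_uniq // => /eqP.
Qed.
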